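(* Let $N\ge 2$, let $\{\mathbf{T}_n\}_{0\le n<N}$ be the minimal Hermite-type basis of $\mathbb{R}^N$, and denote $\mathbf{T}_N:=\mathbf{T}_{N-1}$ and $K_m:=\lfloor (N+2+m)/4\rfloor$ for $m\in\{0,1,2,3\}$. (i) If $0\le n<K_0$ then $\dim(E_0\cap S_n)=0$. If $K_0\le n\le\lfloor N/2\rfloor$ then $\dim(E_0\cap S_n)=n-K_0+1$ and the vectors $\{\mathbf{T}_{4l}\}_{0\le l\le n-K_0}$ form an orthonormal basis of $E_0\cap S_n$. (ii) If $0\le n<K_1$ then $\dim(E_1\cap S_n)=0$. If $K_1\le n<\lceil N/2\rceil$ then $\dim(E_1\cap S_n)=n-K_1+1$ and the vectors $\{\mathbf{T}_{4l+1}\}_{0\le l\le n-K_1}$ form an orthonormal basis of $E_1\cap S_n$. (iii) If $0\le n<K_2$ then $\dim(E_2\cap S_n)=0$. If $K_2\le n\le\lfloor N/2\rfloor$ then $\dim(E_2\cap S_n)=n-K_2+1$ and the vectors $\{\mathbf{T}_{4l+2}\}_{0\le l\le n-K_2}$ form an orthonormal basis of $E_2\cap S_n$. (iv) If $0\le n<K_3$ then $\dim(E_3\cap S_n)=0$. If $K_3\le n<\lceil N/2\rceil$ then $\dim(E_3\cap S_n)=n-K_3+1$ and the vectors $\{\mathbf{T}_{4l+3}\}_{0\le l\le n-K_3}$ form an orthonormal basis of $E_3\cap S_n$.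
   Context: Let $I_N=\{k\in\mathbb{Z}: -\lceil N/2\rceil+1\le k\le\lfloor N/2\rfloor\}$. Entries of a vector $\mathbf{a}\in\mathbb{C}^N$ (or $\mathbb{R}^N$) are labelled by $I_N$, and $\mathbf{a}$ is identified with the $N$-periodic function on $\mathbb{Z}$ that agrees with it on $I_N$. The dot product is $\langle\mathbf{a},\mathbf{b}\rangle=\sum_{k\in I_N}\mathbf{a}(k)\mathbf{b}(k)$. The (centered) discrete Fourier transform is the linear map $\mathscr{F}$ on $\mathbb{C}^N$ given by $(\mathscr{F}\mathbf{a})(l)=\frac{1}{\sqrt{N}}\sum_{k\in I_N}e^{-\mathrm{i}\omega kl}\mathbf{a}(k)$, $l\in I_N$, with $\omega=2\pi/N$. For a nonzero vector $\mathbf{a}$, $\operatorname{width}(\mathbf{a})$ is the integer $n\in\{0,1,\dots,\lfloor N/2\rfloor\}$ such that $\mathbf{a}(n)\ne 0$ or $\mathbf{a}(-n)\neq 0$, but $\mathbf{a}(k)=0$ whenever $n<|k|\le\lfloor N/2\rfloor$ (with $\mathbf{a}$ viewed as an $N$-periodic function). The minimal Hermite-type basis of $\mathbb{R}^N$ is the family $\{\mathbf{T}_n\}_{0\le n<N}$ of vectors in $\mathbb{R}^N$, unique up to the sign of each vector, such that: (a) each $\mathbf{T}_n$ is an eigenvector of $\mathscr{F}$, with $\mathscr{F}\mathbf{T}_n=(-\mathrm{i})^n\mathbf{T}_n$ for $0\le n<N-1$; (b) $\{\mathbf{T}_n\}_{0\le n<N}$ is an orthonormal basis of $\mathbb{R}^N$;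 (c) $\operatorname{width}(\mathbf{T}_n)\le\lfloor(N+n+2)/4\rfloor$ for $0\le n<N$. (Existence and uniqueness up to signs hold for every $N\ge2$.) For $m\in\{0,1,2,3\}$ and $0\le n\le\lfloor N/2\rfloor$, define the linear subspaces $E_m=\{\mathbf{a}\in\mathbb{R}^N:\mathscr{F}\mathbf{a}=(-\mathrm{i})^m\mathbf{a}\}$ and $S_n=\{\mathbf{a}\in\mathbb{R}^N:\operatorname{width}(\mathbf{a})\le n\}$, where the zero vector is included in $S_n$; that is, $S_n$ consists of the vectors with $\mathbf{a}(k)=0$ for $n<|k|\le\lfloor N/2\rfloor$. *)

(* Defs.v *)
From HB Require Import structures.
From mathcomp Require Import all_boot all_order all_algebra.
From mathcomp Require Import complex.
From mathcomp Require Import boolp classical_sets reals trigo.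
From mathcomp Require Import zify.

Set Implicit Arguments.
Unset Strict Implicit.
Unset Printing Implicit Defensive.

Import Order.TTheory GRing.Theory Num.Theory.

Local Open Scope ring_scope.
Local Open Scope complex_scope.

(* A vector is a row matrix; its entry in column [j : 'I_N] carries the label
   [j - ceil(N/2) + 1], so that the labels run through
   I_N = {- ceil(N/2) + 1, ..., floor(N/2)}.
   Here [uphalf N] is ceil(N/2) and [N./2] is floor(N/2). *)
Definition label (N : nat) (j : 'I_N) : int := j%:Z - (uphalf N)%:Z + 1.

(* The N-periodic function on Z that agrees with [a] on I_N.  For [0 < N] the
   [None] branch is never taken (see [periodic_label] and [periodicDN]). *)
Definition periodic (V : nmodType) (N : nat) (a : 'rV[V]_N) (k : int) : V :=
  if insub `|((k + (uphalf N)%:Z - 1) %% N%:Z)%Z|%N is Some j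
  then a 0 (j : 'I_N) else 0.

Definition dot (R : pzSemiRingType) (N : nat) (a b : 'rV[R]_N) : R :=
  \sum_(k < N) a 0 k * b 0 k.

Definition expi (R : realType) (t : R) : R[i] := cos t +i* sin t.

Definition omega (R : realType) (N : nat) : R := 2 * pi / N%:R.

Definition dft (R : realType) (N : nat) (a : 'rV[R[i]]_N) : 'rV[R[i]]_N :=
  \row_(l < N) (((Num.sqrt N%:R)^-1)%:C *
    \sum_(k < N) expi (- (omega R N * (label k)%:~R * (label l)%:~R)) * a 0 k).

Definition embC (R : realType) (N : nat) (a : 'rV[R]_N) : 'rV[R[i]]_N :=
  map_mx (real_complex R) a.

(* The largest [n] in {0, ..., floor(N/2)} with a(n) <> 0 or a(-n) <> 0; see
   [width_spec].  The empty maximum gives the value 0 at the zero vector. *)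
Definition width (V : nmodType) (N : nat) (a : 'rV[V]_N) : nat :=
  \max_(n < N./2.+1 |
      (periodic a n%:Z != 0) || (periodic a (- n%:Z) != 0)) n.

(* The subspace with membership predicate [P]; meaningful when [P] is closed
   under linear combinations, see [mem_subspace_of]. *)
Definition subspace_of (K : fieldType) (V : vectType K) (P : V -> Prop) :
    {vspace V} :=
  xget 0%VS (fun U : {vspace V} => forall v, v \in U <-> P v).

Definition dft_eigenspace (R : realType) (N m : nat) : {vspace 'rV[R]_N} :=
  subspace_of (fun a => dft (embC a) = (- 'i) ^+ m *: embC a).

Definition width_space (R : realType) (N n : nat) : {vspace 'rV[R]_N} :=
  subspace_of (fun a => (width a <= n)%N).

Definition orthonormal (R : realType) (N : nat) (s : seq 'rV[R]_N) : Prop :=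
  forall i j, (i < size s)%N -> (j < size s)%N ->
    dot s`_i s`_j = (i == j)%:R.

Definition orthonormal_basis (R : realType) (N : nat)
    (U : {vspace 'rV[R]_N}) (s : seq 'rV[R]_N) : Prop :=
  basis_of U s /\ orthonormal s.

Definition dft_eigenvector (R : realType) (N : nat) (a : 'rV[R]_N) : Prop :=
  a != 0 /\ exists lambda : R[i], dft (embC a) = lambda *: embC a.

(* Only the values [T n] with [n < N] matter. *)
Definition minimal_hermite_basis (R : realType) (N : nat)
    (T : nat -> 'rV[R]_N) : Prop :=
  [/\ forall n, (n < N)%N -> dft_eigenvector (T n),
      forall n, (n < N.-1)%N -> dft (embC (T n)) = (- 'i) ^+ n *: embC (T n),
      orthonormal_basis fullv (mkseq T N)
    & forall n, (n < N)%N -> (width (T n) <= (N + n + 2) %/ 4)%N].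

(* The family extended by the convention T_N := T_{N-1}. *)
Definition extT (R : realType) (N : nat) (T : nat -> 'rV[R]_N) (n : nat) :
    'rV[R]_N :=
  if n == N then T N.-1 else T n.

Definition Kbound (N m : nat) : nat := (N + 2 + m) %/ 4.

Lemma label_bounds (N : nat) (k : int) :
  (- (uphalf N)%:Z + 1 <= k <= (N./2)%:Z) <-> exists j : 'I_N, label j = k.
Proof.
have hN : (uphalf N + N./2 = N)%N by rewrite uphalf_half -addnA addnn odd_double_half.
split=> [hk|[j <-]]; last by rewrite /label; have := ltn_ord j; lia.
have hj : (absz (k + (uphalf N)%:Z - 1)%R < N)%N by lia.
by exists (Ordinal hj); rewrite /label /=; lia.
Qed.

Lemma periodic_label (V : nmodType) (N : nat) (a : 'rV[V]_N) (j : 'I_N) :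
  periodic a (label j) = a 0 j.
Proof.
rewrite /periodic /label.
have -> : j%:Z - (uphalf N)%:Z + 1 + (uphalf N)%:Z - 1 = j%:Z by lia.
rewrite modz_small; last by have := ltn_ord j; lia.
by rewrite /= valK.
Qed.

Lemma periodicDN (V : nmodType) (N : nat) (a : 'rV[V]_N) (k : int) :
  periodic a (k + N%:Z) = periodic a k.
Proof.
rewrite /periodic.
have -> : k + N%:Z + (uphalf N)%:Z - 1 = (k + (uphalf N)%:Z - 1) + N%:Z by lia.
by rewrite modzDr.
Qed.

Lemma width_leP (V : nmodType) (N : nat) (a : 'rV[V]_N) (n : nat) :
  (width a <= n)%N <->
  (forall k : int, (n < `|k| <= N./2)%N -> periodic a k = 0).
Proof.
split=> [/bigmax_leqP h k /andP[nk kN]|h].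
  apply: contraTeq nk => ak; rewrite -leqNgt.
  have kN' : (`|k| < N./2.+1)%N by [].
  apply: (h (Ordinal kN')) => /=.
  by case: (lerP 0 k) ak => k0; [rewrite gez0_abs // => -> |
    rewrite lez0_abs ?ltW // opprK => ->; rewrite orbT].
apply/bigmax_leqP => i; apply: contraLR; rewrite -ltnNge => ni.
have iN : (i <= N./2)%N by rewrite -ltnS.
by rewrite !h ?eqxx // ?abszN /= ni.
Qed.

Lemma width_spec (V : nmodType) (N : nat) (a : 'rV[V]_N) : a != 0 ->
  [/\ (width a <= N./2)%N,
      periodic a (width a)%:Z != 0 \/ periodic a (- (width a)%:Z) != 0
    & forall k : int, (width a < `|k| <= N./2)%N -> periodic a k = 0].
Proof.
move=> a0; split; last by apply/width_leP.
  by apply/bigmax_leqP => i _; rewrite -ltnS.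
have [j aj] : exists j, a 0 j != 0.
  apply/existsP; apply: contraNT a0; rewrite negb_exists => /forallP h.
  by apply/eqP/rowP => j; rewrite mxE; apply/eqP; have := h j; rewrite negbK.
have hj : (`|label j| < N./2.+1)%N.
  have := (label_bounds N (label j)).2 (ex_intro _ j erefl).
  have hN : (uphalf N <= N./2.+1)%N by rewrite uphalf_half -add1n leq_add2r leq_b1.
  by lia.
pose P (n : 'I_N./2.+1) :=
  (periodic a n%:Z != 0) || (periodic a (- n%:Z) != 0).
have Pj : P (Ordinal hj).
  rewrite /P /=; rewrite -(periodic_label a) in aj.
  case: (lerP 0 (label j)) aj => k0; first by rewrite gez0_abs // => ->.
  by rewrite lez0_abs ?ltW // opprK => ->; rewrite orbT.
have [i Pi ->] : exists2 i, P i & width a = i.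
  have Pn : (0 < #|P|)%N by apply/card_gt0P; exists (Ordinal hj).
  by have [q] := eq_bigmax_cond (fun n : 'I_(N./2.+1) => n : nat) Pn; exists q.
by apply/orP.
Qed.

Lemma mem_subspace_of (F : fieldType) (V : vectType F) (P : V -> Prop) :
  P 0 -> (forall c u v, P u -> P v -> P (c *: u + v)) ->
  forall v, v \in subspace_of P <-> P v.
Proof.
move=> P0 PD.
suff [U hU] : exists U : {vspace V}, forall v, v \in U <-> P v.
  exact: (@xgetPex _ 0%VS (fun U : {vspace V} => forall v, v \in U <-> P v)
    (ex_intro _ U hU)).
suff H : forall n (U : {vspace V}), (\dim {:V} - \dim U <= n)%N ->
    (forall v, v \in U -> P v) ->
    exists U : {vspace V}, forall v, v \in U <-> P v.
  by apply: (H _ 0%VS (leqnn _)) => v; rewrite memv0 => /eqP ->.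
elim=> [|n IH] U hd hU.
  exists U => v; split; first exact: hU.
  have /eqP -> : U == fullv.
    by rewrite eqEdim subvf /= -subn_eq0 -leqn0.
  by rewrite memvf.
case: (pselect (forall v, P v -> v \in U)) => [h|/existsNP[v /not_implyP[Pv vU]]].
  by exists U => v; split; [exact: hU | exact: h].
apply: (IH (U + <[v]>)%VS); last first.
  move=> w /memv_addP[u uU [_ /vlineP[c ->] ->]].
  by rewrite addrC; apply: PD => //; exact: hU.
have UV : (U <= U + <[v]>)%VS by exact: addvSl.
have lt : (\dim U < \dim (U + <[v]>))%N.
  rewrite ltn_neqAle dimvS // andbT; apply/negP => /eqP e.
  have /eqP eU : U == (U + <[v]>)%VS by rewrite eqEdim UV e leqnn.
  by apply: vU; rewrite eU (subvP (addvSr _ _)) // memv_line.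
by have := dimvS (subvf (U + <[v]>)%VS); lia.
Qed.

Lemma dft_linear (R : realType) (N : nat) (c : R[i]) (a b : 'rV[R[i]]_N) :
  dft (c *: a + b) = c *: dft a + dft b.
Proof.
apply/rowP => l; rewrite !mxE (mulrCA c) -mulrDr [c * _]mulr_sumr -big_split /=.
by congr (_ * _); apply: eq_bigr => k _; rewrite !mxE mulrDr mulrCA.
Qed.

Lemma mem_dft_eigenspace (R : realType) (N m : nat) (a : 'rV[R]_N) :
  a \in dft_eigenspace R N m <-> dft (embC a) = (- 'i) ^+ m *: embC a.
Proof.
have embCD (c : R) (u v : 'rV[R]_N) : embC (c *: u + v) = c%:C *: embC u + embC v.
  by rewrite /embC map_mxD map_mxZ.
apply: mem_subspace_of a => [|c u v hu hv].
  have -> : embC (0 : 'rV[R]_N) = 0 by rewrite /embC map_mx0.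
  rewrite scaler0; apply/rowP => l; rewrite !mxE big1 ?mulr0 // => k _.
  by rewrite mxE mulr0.
by rewrite embCD dft_linear hu hv scalerDr !scalerA mulrC.
Qed.

Lemma mem_width_space (R : realType) (N n : nat) (a : 'rV[R]_N) :
  a \in width_space R N n <-> (width a <= n)%N.
Proof.
have perD (c : R) (u v : 'rV[R]_N) k :
    periodic (c *: u + v) k = c * periodic u k + periodic v k.
  by rewrite /periodic; case: insubP => [j _ _|_]; rewrite ?mxE ?mulr0 ?addr0.
apply: mem_subspace_of a => [|c u v /width_leP hu /width_leP hv].
  apply/width_leP => k _; rewrite /periodic.
  by case: insubP => // j _ _; rewrite mxE.
by apply/width_leP => k hk; rewrite perD hu // hv // mulr0 addr0.
Qed.

(* Main.v *)
From mathcomp Require Import all_boot all_order all_algebra.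
From mathcomp Require Import complex zify ring lra.
From mathcomp Require Import reals trigo.
Require Import Defs.

(** The subspace E_m /\ S_n has a dimension that can be bounded without any
    reference to the basis, and the bound is attained by the vectors T_(4l+m).

    The key point is that E_m contains no nonzero vector supported on labels of
    absolute value less than K_m ([dft_eigenvector_small_support]).  The square of
    the transform is the reflection a(k) |-> a(-k) ([dft_dft]), so the vectors of
    E_m are even for m = 0, 2 and odd for m = 1, 3.  Hence the transform of a
    vector of E_m with support in |k| <= n is, as a function of the label l, a
    polynomial in cos (omega l), of degree at most n when m is even, and sin
    (omega l) times one of degree at most n - 1 when m is odd.  The transform is
    proportional to the vector itself, so this polynomial vanishes at all the
    points cos (omega l) with l > n in the half period.  For n < K_m these roots
    outnumber the degree, except that for m = 2, 3 and n = K_m - 1 they may be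
    exactly as many as the degree; then the sign of the eigenvalue is incompatible
    with the sign of the polynomial beyond its largest root.

    By parity, a vector of E_m with width at most n is therefore determined by its
    values at the labels K_m, ..., n, and the dimension of the intersection is at
    most n + 1 - K_m ([dim_eigen_width_le]).  The width bound on T_(4l+m) puts it
    into S_n for l <= n - K_m, which yields exactly that many orthonormal vectors.
    What remains is the eigenvalue of the last vector T_(N-1).  It is a fourth root
    of unity, again because the transform squares to a reflection, and the
    dimension bounds for the classes other than the predicted one are exhausted by
    the earlier vectors ([last_eigenspace]). *)

Set Implicit Arguments.
Unset Strict Implicit.
Unset Printing Implicit Defensive.

Import Order.TTheory GRing.Theory Num.Theory.
Local Open Scope ring_scope.
Local Open Scope complex_scope.

(** * The square of the Fourier transform *)

Lemma expiD (R : realType) (s t : R) : expi (s + t) = expi s * expi t.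
Proof. by rewrite /expi cosD sinD; simpc; rewrite [sin s * cos t + _]addrC. Qed.

Lemma expi0 (R : realType) : expi (0 : R) = 1.
Proof. by rewrite /expi cos0 sin0. Qed.

Lemma expiMn (R : realType) (t : R) n : expi (t *+ n) = expi t ^+ n.
Proof. by elim: n => [|n IH]; rewrite ?mulr0n ?expi0 // mulrS exprS expiD IH. Qed.

Lemma expi_2pi (R : realType) (d : int) : expi (2 * pi * d%:~R : R) = 1.
Proof.
have h n : expi (2 * pi * n%:R : R) = 1.
  by rewrite -mulrA mulr_natl -mulr_natr mulrAC mulr_natr expiMn /expi [pi * 2]mulr_natr
     cos2pi sin2pi expr1n.
case: d => n; first exact: h.
have := expiD (2 * pi * n.+1%:R) (2 * pi * (Negz n)%:~R : R).
by rewrite h NegzE mulrNz mulrN subrr expi0 mul1r.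
Qed.

Lemma omega_gt0 (R : realType) (N : nat) : (0 < N)%N -> 0 < omega R N.
Proof. by move=> N0; rewrite /omega divr_gt0 ?mulr_gt0 ?pi_gt0 ?ltr0n. Qed.

Lemma omegaN (R : realType) (N : nat) : (0 < N)%N -> omega R N * N%:R = 2 * pi.
Proof. by move=> N0; rewrite /omega divfK // pnatr_eq0 -lt0n. Qed.

Lemma expi_omega_modz (R : realType) (N : nat) (d : int) : (0 < N)%N ->
  expi (omega R N * d%:~R) = expi (omega R N * (d %% N)%Z%:~R).
Proof.
move=> N0; rewrite {1}(divz_eq d N) intrD intrM mulrDr expiD.
have -> : omega R N * ((d %/ N)%Z%:~R * N%:~R) = 2 * pi * (d %/ N)%Z%:~R.
  by rewrite -(omegaN R N0) -mulrA; congr (_ * _); rewrite mulrC.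
by rewrite expi_2pi mul1r.
Qed.

(** Halving the angle replaces cos t = 1 by sin (t/2) = 0, which is impossible
    for 0 < t < 2 pi. *)
Lemma expi_omega_eq1 (R : realType) (N : nat) (d : int) : (0 < N)%N ->
  (expi (omega R N * d%:~R) == 1) = (N %| d)%Z.
Proof.
move=> N0; rewrite expi_omega_modz //.
have N0z : N%:Z != 0 by lia.
case: (eqVneq (d %% N)%Z 0) => [d0|d0].
  by rewrite d0 mulr0 expi0 eqxx; apply/esym/dvdz_mod0P.
have -> : (N %| d)%Z = false by apply/negP => /dvdz_mod0P; apply/eqP.
have r0 := modz_ge0 d N0z; have rN : ((d %% N)%Z < N)%R by apply: ltz_pmod; lia.
move: (d %% N)%Z d0 r0 rN => r d0 r0 rN.
apply/negP; rewrite eq_complex /= => /andP[/eqP hc _].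
have s0 : 0 < sin (pi / N%:R * r%:~R : R).
  apply: sin_gt0_pi; rewrite mulr_gt0 ?divr_gt0 ?pi_gt0 ?ltr0n ?ltr0z //=; last lia.
  rewrite -mulrA gtr_pMr ?pi_gt0 // ltr_pdivrMl ?ltr0n // mulr1.
  by rewrite -[N%:R]/(N%:~R) ltr_int.
move: hc; have -> : omega R N * r%:~R = (pi / N%:R * r%:~R) *+ 2.
  by rewrite /omega -mulr_natr; ring.
rewrite cos_mulr2n cos2sin2 => hc.
by have := exprn_gt0 2 s0; lra.
Qed.

(** Up to the shift of labels this is a geometric sum with ratio an N-th root
    of unity. *)
Lemma sum_expi_label (R : realType) (N : nat) (d : int) : (0 < N)%N ->
  \sum_(k < N) expi (omega R N * (label k * d)%:~R) = ((N %| d)%Z)%:R * N%:R.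
Proof.
move=> N0; set w := omega R N; set z := expi (w * d%:~R).
have -> : \sum_(k < N) expi (w * (label k * d)%:~R) =
    expi (w * ((1 - (uphalf N)%:Z) * d)%:~R) * \sum_(k < N) z ^+ k.
  rewrite mulr_sumr; apply: eq_bigr => k _.
  rewrite -expiMn -expiD; congr expi; rewrite /label -mulr_natl.
  rewrite !intrM !intrD !intrN -[k%:R]/(k%:~R); ring.
case: (boolP (N %| d)%Z) => Nd.
  have z1 : z = 1 by apply/eqP; rewrite expi_omega_eq1.
  have -> : expi (w * ((1 - (uphalf N)%:Z) * d)%:~R) = 1.
    by apply/eqP; rewrite expi_omega_eq1 // dvdz_mull.
  rewrite !mul1r (eq_bigr (fun=> 1)); last by move=> k _; rewrite z1 expr1n.
  by rewrite sumr_const card_ord.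
have z1 : z != 1 by rewrite expi_omega_eq1.
have : (z - 1) * \sum_(k < N) z ^+ k = 0.
  rewrite -subrX1 -expiMn -mulr_natr mulrAC omegaN // expi_2pi subrr //.
move/eqP; rewrite mulf_eq0 subr_eq0 (negbTE z1) /= => /eqP ->.
by rewrite mulr0 mul0r.
Qed.

Lemma label_modz_inj (N : nat) (i j : 'I_N) :
  (N %| label i - label j)%Z -> i = j.
Proof.
rewrite /label => h; apply/val_inj => /=.
have {h} : (N %| i%:Z - j%:Z)%Z by move: h; congr (_ %| _)%Z; ring.
rewrite -eqz_mod_dvd !modz_small; first by move/eqP=> [].
  by have := ltn_ord j; lia.
by have := ltn_ord i; lia.
Qed.

(** Congruences of labels are the working form of periodicity: they avoid
    computing which index carries a given residue. *)
Lemma periodic_modz (V : nmodType) (N : nat) (a : 'rV[V]_N) (k : int) (j : 'I_N) :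
  (N %| k - label j)%Z -> periodic a k = a 0 j.
Proof.
move=> /dvdzP[q hq]; rewrite -(periodic_label a j).
have -> : k = label j + q * N by rewrite -hq; ring.
have aux n x : periodic a (x + n%:Z * N) = periodic a x.
  elim: n x => [|n IH] x; first by rewrite mul0r addr0.
  by rewrite intS mulrDl mul1r [N%:Z + _]addrC addrA periodicDN IH.
case: q {hq} => n; first exact: aux.
rewrite NegzE -[LHS](@aux n.+1); congr periodic; ring.
Qed.

Lemma exists_label_modz (N : nat) (k : int) : (0 < N)%N ->
  exists j : 'I_N, (N %| k - label j)%Z.
Proof.
move=> N0; pose r := ((k + (uphalf N)%:Z - 1) %% N)%Z.
have r0 : 0 <= r by apply: modz_ge0; lia.
have rN : r < N by apply: ltz_pmod; lia.
have rN' : (`|r| < N)%N by lia.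
exists (Ordinal rN'); rewrite /label /= gez0_abs //.
have -> : k - (r - (uphalf N)%:Z + 1) = (k + (uphalf N)%:Z - 1) - r by ring.
by rewrite {1}(divz_eq (k + (uphalf N)%:Z - 1) N) -/r addrK dvdz_mull.
Qed.

(** The transform squares to the reflection a(k) |-> a(-k); stating it for a pair
    of indices with labels opposite modulo N avoids naming the reflected index. *)
Lemma dft_dft (R : realType) (N : nat) (v : 'rV[R[i]]_N) (l j : 'I_N) :
  (N %| label l + label j)%Z -> dft (dft v) 0 l = v 0 j.
Proof.
move=> hlj; have N0 : (0 < N)%N by apply: leq_ltn_trans (ltn_ord l).
have sN : ((Num.sqrt N%:R)^-1)%:C * ((Num.sqrt N%:R)^-1)%:C = (N%:R^-1 : R)%:C.
  by rewrite -rmorphM /= -invfM -expr2 sqr_sqrtr ?ler0n.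
have NC : (N%:R^-1 : R)%:C * N%:R = 1.
  rewrite -(rmorph_nat (real_complex R) N) -rmorphM /= mulVf //.
  by rewrite pnatr_eq0 -lt0n.
rewrite mxE (eq_bigr (fun k => \sum_(i < N) ((Num.sqrt N%:R)^-1)%:C *
   (expi (omega R N * (label k * - (label l + label i))%:~R) * v 0 i))); last first.
  move=> k _; rewrite mxE mulrCA [X in _ * X]mulr_sumr mulr_sumr; apply: eq_bigr => i _.
  congr (_ * _); rewrite mulrA -expiD; congr (expi _ * _).
  by rewrite !intrM !intrN intrD; ring.
rewrite exchange_big mulr_sumr (bigD1 j) //= [X in _ + X]big1 => [|i ij].
  rewrite addr0 -mulr_sumr -mulr_suml; apply: (etrans (mulrA _ _ _)).
  apply: (etrans (congr1 ( *%R^~ _) sN)).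
  rewrite sum_expi_label // rpredN hlj mul1r.
  by rewrite mulrA NC mul1r.
rewrite -mulr_sumr -mulr_suml sum_expi_label // rpredN.
suff -> : (N %| label l + label i)%Z = false by rewrite !mul0r !mulr0.
apply/negP => h; move: ij; rewrite (@label_modz_inj _ i j) ?eqxx //.
have -> : label i - label j = (label l + label i) - (label l + label j) by ring.
by rewrite rpredB.
Qed.

Lemma dftZ (R : realType) (N : nat) (c : R[i]) (v : 'rV[R[i]]_N) :
  dft (c *: v) = c *: dft v.
Proof.
apply: (addIr (dft 0)); rewrite -dft_linear addr0.
apply/rowP => l; rewrite !mxE [X in _ + _ * X]big1 ?mulr0 ?addr0 //.
by move=> k _; rewrite mxE mulr0.
Qed.

(** Every eigenvector is thus multiplied by lambda^2 under reflection; this gives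
    both its parity and the possible values of lambda. *)
Lemma eigen_sqr (R : realType) (N : nat) (a : 'rV[R]_N) (lambda : R[i]) (l j : 'I_N) :
  dft (embC a) = lambda *: embC a -> (N %| label l + label j)%Z ->
  lambda ^+ 2 * (a 0 l)%:C = (a 0 j)%:C.
Proof.
move=> ha /(@dft_dft _ _ (embC a)).
by rewrite ha dftZ ha scalerA -expr2 !mxE => <-.
Qed.

Lemma exists_opp_label (N : nat) (l : 'I_N) :
  exists j : 'I_N, (N %| label l + label j)%Z.
Proof.
have N0 : (0 < N)%N by apply: leq_ltn_trans (ltn_ord l).
have [j hj] := exists_label_modz (- label l) N0; exists j.
by rewrite -rpredN opprD.
Qed.

Lemma dft_eigenvalueP (R : realType) (N : nat) (a : 'rV[R]_N) (lambda : R[i]) :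
  a != 0 -> dft (embC a) = lambda *: embC a ->
  exists2 m, (m < 4)%N & lambda = (- 'i) ^+ m.
Proof.
move=> a0 ha.
have [l al] : exists l, a 0 l != 0.
  apply/existsP; apply: contraNT a0; rewrite negb_exists => /forallP h.
  by apply/eqP/rowP => j; rewrite mxE; apply/eqP; have := h j; rewrite negbK.
have [j hlj] := exists_opp_label l.
have hjl : (N %| label j + label l)%Z by rewrite addrC.
have e1 := eigen_sqr ha hlj; have e2 := eigen_sqr ha hjl.
have e : (lambda ^+ 4 - 1) * (a 0 l)%:C = 0.
  by rewrite mulrBl mul1r -[X in _ - X]e2 -e1; ring.
have i2 : ('i : R[i]) ^+ 2 = -1 by exact: sqr_i.
have al' : (a 0 l)%:C != 0 :> R[i] by rewrite eq_complex /= negb_and al.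
move/eqP: e; rewrite mulf_eq0 (negbTE al') orbF.
have -> : lambda ^+ 4 - 1 =
    (lambda - 1) * (lambda + 1) * ((lambda + 'i) * (lambda - 'i)).
  have -> : (lambda + 'i) * (lambda - 'i) = lambda ^+ 2 - 'i ^+ 2 by ring.
  by rewrite i2; ring.
have i3 : (- 'i : R[i]) ^+ 3 = 'i by rewrite exprS sqrrN i2 mulrN1 opprK.
rewrite !mulf_eq0 !subr_eq0 !addr_eq0 => /orP[/orP[]|/orP[]] /eqP ->.
- by exists 0%N.
- by exists 2%N; rewrite // sqrrN i2.
- by exists 1%N.
- by exists 3%N; rewrite // i3.
Qed.

(** * Eigenvectors as trigonometric polynomials *)

Definition trig (R : realType) (m : nat) (t : R) : R :=
  if odd m then sin t else cos t.

Lemma sum_complex (R : realType) (I : finType) (x y : I -> R) :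
  \sum_k (x k +i* y k) = (\sum_k x k) +i* (\sum_k y k).
Proof.
by elim/big_rec3: _ => [//|k u v w _ ->]; simpc.
Qed.

Lemma dft_embC (R : realType) (N : nat) (a : 'rV[R]_N) (l : 'I_N) :
  let t k : R := omega R N * (label k)%:~R * (label l)%:~R in
  dft (embC a) 0 l = ((Num.sqrt N%:R)^-1)%:C *
    ((\sum_k cos (t k) * a 0 k) -i* (\sum_k sin (t k) * a 0 k)).
Proof.
move=> t; rewrite mxE -sumrN -sum_complex; congr (_ * _).
apply: eq_bigr => k _; rewrite mxE /expi cosN sinN -/(t k).
by simpc.
Qed.

(** The transform of a real vector has the cosine sum as real part and minus the
    sine sum as imaginary part, and the eigenvalue is real for m = 0, 2 and
    imaginary for m = 1, 3.  The two classes with the same parity are told apart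
    only by the sign (-1)^(m/2), on which the sharp case of
    [dft_eigenvector_small_support] rests. *)
Lemma eigen_trig (R : realType) (N m : nat) (a : 'rV[R]_N) (l : 'I_N) :
  (m < 4)%N -> dft (embC a) = (- 'i) ^+ m *: embC a ->
  \sum_k trig m (omega R N * (label k)%:~R * (label l)%:~R) * a 0 k =
  (-1) ^+ m./2 * Num.sqrt N%:R * a 0 l.
Proof.
move=> m4 ha; have N0 : (0 < N)%N by apply: leq_ltn_trans (ltn_ord l).
have s0 : Num.sqrt N%:R != 0 :> R by rewrite sqrtr_eq0 -ltNge ltr0n.
have := dft_embC a l; rewrite ha !mxE /=.
set C := \sum_k _; set S := \sum_k _ => /(congr1 (fun z => (Num.sqrt N%:R)%:C * z)).
rewrite [RHS]mulrA -rmorphM /= divff // mul1r.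
rewrite /C /S /trig; case: m m4 ha => [|[|[|[|//]]]] _ _ /=; simpc.
all: rewrite ?exprS ?expr0; simpc => -[] e1 e2.
- by rewrite -e1 mulrC.
- by apply: oppr_inj; rewrite -e2; ring.
- by rewrite -e1; ring.
- by apply: oppr_inj; rewrite -e2; ring.
Qed.

(** The largest label at which an eigenvector of class m may be nonzero: an odd
    vector vanishes at N/2 when N is even. *)
Definition max_label (N m : nat) : nat :=
  if odd m then (uphalf N).-1 else N./2.

(** Chebyshev polynomials of both kinds under one recursion: [cheb R m k] is T_k
    for even m and U_(k-1) for odd m, with U_(-1) = 0, so that cos (k t) or
    sin (k t) is [trig_weight m t] times its value at cos t. *)
Fixpoint cheb_pair (R : comNzRingType) (m k : nat) : {poly R} * {poly R} :=
  if k is k'.+1 then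
    let: (u, v) := cheb_pair R m k' in (v, 'X *+ 2 * v - u)
  else if odd m then (0, 1) else (1, 'X).

Definition cheb (R : comNzRingType) (m k : nat) : {poly R} := (cheb_pair R m k).1.

Lemma chebSS (R : comNzRingType) m k :
  cheb R m k.+2 = 'X *+ 2 * cheb R m k.+1 - cheb R m k.
Proof. by rewrite /cheb /=; case: (cheb_pair R m k). Qed.

Lemma cheb0 (R : comNzRingType) m : cheb R m 0 = if odd m then 0 else 1.
Proof. by rewrite /cheb /=; case: ifP. Qed.

Lemma cheb1 (R : comNzRingType) m : cheb R m 1 = if odd m then 1 else 'X.
Proof. by rewrite /cheb /=; case: ifP. Qed.

Definition trig_weight (R : realType) (m : nat) (t : R) : R :=
  if odd m then sin t else 1.

Lemma cheb_trig (R : realType) m k (t : R) :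
  (cheb R m k).[cos t] * trig_weight m t = trig m (t *+ k).
Proof.
pose P k := (cheb R m k).[cos t] * trig_weight m t = trig m (t *+ k).
suff: P k /\ P k.+1 by case.
elim: k => [|k [IH0 IH1]].
  rewrite /P cheb0 cheb1 /trig_weight /trig mulr0n mulr1n.
  by case: (odd m); rewrite !hornerE ?mul0r ?mul1r ?mulr1 ?sin0 ?cos0.
split=> //; rewrite /P chebSS hornerD hornerN hornerM hornerMn hornerX mulrBl -mulrA.
rewrite IH0 IH1 /trig (mulrS t k.+1).
have -> : t *+ k = t *+ k.+1 - t by rewrite mulrSr addrK.
by case: (odd m); rewrite ?sinD ?cosD ?sinN ?cosN; ring.
Qed.

Lemma size_cheb (R : comNzRingType) m k : (size (cheb R m k) <= k + ~~ odd m)%N.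
Proof.
pose P k := (size (cheb R m k) <= k + ~~ odd m)%N.
suff: P k /\ P k.+1 by case.
elim: k => [|k [IH0 IH1]].
  rewrite /P cheb0 cheb1.
  by case: (odd m); rewrite /= ?size_poly0 ?size_poly1 ?size_polyX.
split=> //; rewrite /P chebSS (leq_trans (size_polyD _ _)) // geq_max size_polyN.
rewrite (leq_trans IH0) ?leq_add2r ?andbT; last by lia.
rewrite mulrnAl -mulrnAr; have [->|q0] := eqVneq (cheb R m k.+1 *+ 2) 0.
  by rewrite mulr0 size_poly0.
rewrite (leq_trans (size_polyMleq _ _)) // size_polyX /=.
rewrite addSn ltnS; apply: leq_trans IH1.
by apply/leq_sizeP => i hi; rewrite coefMn nth_default ?mul0rn.
Qed.

(** The index [d + odd m] is the one for which the degree is exactly d. *)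
Lemma coef_cheb_gt0 (R : realDomainType) m d : 0 < (cheb R m (d + odd m))`_d.
Proof.
elim: d => [|d IH].
  rewrite add0n; have := cheb0 R m; have := cheb1 R m.
  by case: (odd m) => /= e1 e0; rewrite ?e1 ?e0 coef1 ltr01.
case: d IH => [|d] IH.
  have := cheb1 R m; have := cheb0 R m; have := chebSS R m 0.
  case: (odd m) => /= e2 e0 e1; rewrite ?addn1 ?addn0.
    rewrite e2 e1 e0 subr0 mulr1 coefMn coefX /=; exact: ltr0Sn.
  by rewrite e1 coefX ltr01.
rewrite addSn addSn chebSS coefB mulrnAl coefMn coefXM /= -addSn.
rewrite [X in _ - X]nth_default ?subr0 ?pmulrn_lgt0 //.
by rewrite (leq_trans (size_cheb _ _ _)) //; case: (odd m); rewrite /=; lia.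
Qed.

Lemma poly_roots_lead (R : fieldType) (p : {poly R}) (rs : seq R) :
  (size p <= (size rs).+1)%N -> all (root p) rs -> uniq rs ->
  p = p`_(size rs) *: \prod_(z <- rs) ('X - z%:P).
Proof.
move=> sp rp urs; have [p0|p0] := eqVneq p 0; first by rewrite p0 coef0 scale0r.
have sz : size p = (size rs).+1.
  by apply/eqP; rewrite eqn_leq sp max_poly_roots.
by rewrite {1}(all_roots_prod_XsubC sz rp) ?uniq_rootsE // lead_coefE sz.
Qed.

Lemma omega_itv (R : realType) (N k : nat) : (0 < N)%N -> (k <= N./2)%N ->
  omega R N * k%:R \in `[0, pi].
Proof.
move=> N0 kN; rewrite in_itv /= mulr_ge0 ?ler0n ?(ltW (omega_gt0 _ _)) //=.
have : omega R N * (k%:R * 2) <= omega R N * N%:R.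
  rewrite ler_pM2l ?omega_gt0 // -natrM ler_nat; lia.
by rewrite omegaN //; lra.
Qed.

Lemma cos_omega_lt (R : realType) (N j k : nat) :
  (0 < N)%N -> (j < k <= N./2)%N -> cos (omega R N * k%:R) < cos (omega R N * j%:R).
Proof.
move=> N0 /andP[jk kN]; rewrite ltr_cos ?omega_itv //; last lia.
by rewrite ltr_pM2l ?omega_gt0 // ltr_nat.
Qed.

Lemma trig_weight_gt0 (R : realType) (N m k : nat) :
  (odd m <= k <= max_label N m)%N -> 0 < trig_weight m (omega R N * k%:R).
Proof.
rewrite /trig_weight /max_label; case: (odd m) => // /andP[k0 kN].
have N0 : (0 < N)%N by lia.
apply: sin_gt0_pi; rewrite mulr_gt0 ?omega_gt0 ?ltr0n //=.
have : omega R N * (k%:R * 2) < omega R N * N%:R.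
  rewrite ltr_pM2l ?omega_gt0 // -natrM ltr_nat; lia.
by rewrite omegaN //; lra.
Qed.

(** Since sin is odd, the labels k and -k carry opposite signs in a sine sum;
    moving the sign into the coefficient leaves a sum over absolute values. *)
Definition fold_parity (R : realType) (N m : nat) (a : 'rV[R]_N) (j : 'I_N) : R :=
  if odd m && (label j < 0) then - a 0 j else a 0 j.

Definition cheb_poly (R : realType) (N m : nat) (a : 'rV[R]_N) : {poly R} :=
  \sum_(j < N) fold_parity m a j *: cheb R m `|label j|.

Lemma cheb_polyE (R : realType) (N m : nat) (a : 'rV[R]_N) (l : 'I_N) :
  (m < 4)%N -> dft (embC a) = (- 'i) ^+ m *: embC a ->
  (cheb_poly m a).[cos (omega R N * (label l)%:~R)] *
    trig_weight m (omega R N * (label l)%:~R) =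
  (-1) ^+ m./2 * Num.sqrt N%:R * a 0 l.
Proof.
set t := omega R N * _ => m4 ha.
rewrite -(eigen_trig l m4 ha) /cheb_poly horner_sum mulr_suml.
apply: eq_bigr => j _; rewrite hornerZ -mulrA cheb_trig.
have -> : omega R N * (label j)%:~R * (label l)%:~R = t * (label j)%:~R.
  by rewrite /t mulrAC.
rewrite /fold_parity /trig mulrC.
have [l0|l0] := ltrP (label j) 0; last first.
  rewrite andbF; have -> // : t * (label j)%:~R = t *+ `|label j|.
  by rewrite mulrzr pmulrn gez0_abs.
rewrite andbT; have -> : t * (label j)%:~R = - (t *+ `|label j|).
  by rewrite mulrzr pmulrn -mulrNz; congr (_ *~ _); lia.
by case: (odd m); rewrite ?sinN ?cosN ?mulrNN ?mulNr ?mulrN.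
Qed.

Lemma eigen_parity (R : realType) (N m : nat) (a : 'rV[R]_N) (i j : 'I_N) :
  dft (embC a) = (- 'i) ^+ m *: embC a -> label i = - label j ->
  a 0 i = (-1) ^+ m * a 0 j.
Proof.
move=> ha hij; have Nij : (N %| label j + label i)%Z by rewrite hij subrr dvdz0.
have := eigen_sqr ha Nij; have i2 : ('i : R[i]) ^+ 2 = -1 by exact: sqr_i.
rewrite exprAC sqrrN i2 -(rmorphN1 (real_complex R)) -rmorphXn -rmorphM /=.
by move=> [].
Qed.

Lemma fold_parity_abs (R : realType) (N m : nat) (a : 'rV[R]_N) (i j : 'I_N) :
  dft (embC a) = (- 'i) ^+ m *: embC a ->
  label i = `|label j|%:Z -> fold_parity m a j = a 0 i.
Proof.
move=> ha hij; rewrite /fold_parity.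
have [j0|j0] := ltrP (label j) 0; last first.
  rewrite andbF; suff -> : j = i by [].
  by apply: label_modz_inj; rewrite hij gez0_abs // subrr dvdz0.
have -> : a 0 i = (-1) ^+ m * a 0 j by apply: eigen_parity => //; lia.
by rewrite andbT -signr_odd; case: (odd m); rewrite ?expr0 ?expr1 ?mul1r ?mulN1r.
Qed.

(** * No eigenvector has small support *)

(** For a vector supported on labels of absolute value below K, the quantity
    K - odd m bounds the size of its Chebyshev polynomial, and M + 1 - K is the
    number of labels between K and M, each of which gives a root. *)
Lemma Kbound_count (N m : nat) : (2 <= N)%N -> (m < 4)%N ->
  let K := Kbound N m in let M := max_label N m in
  [/\ (0 < K)%N, (K <= M.+1)%N &
     (K - odd m <= M.+1 - K)%N \/
     [&& (2 <= m)%N, K - odd m == (M.+1 - K).+1 & K.-1 <= M]%N].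
Proof.
move=> N2 m4 /=; rewrite /Kbound /max_label.
case: m m4 => [|[|[|[|//]]]] _ /=; split; lia.
Qed.

(** Being an eigenvector, [a] is small in support also on the transform side, so
    its Chebyshev polynomial p has a root cos (omega k) for each label k between
    K and M.  In general these are too many roots.  Otherwise they are all the
    roots, and m >= 2: then p beyond its largest root has the sign of its leading
    coefficient, hence of a(n) for n = K - 1, while the eigenvalue equation gives
    p (cos (omega n)) the sign of - a(n); so a(n) = 0 and p = 0. *)
Lemma dft_eigenvector_small_support (R : realType) (N m : nat) (a : 'rV[R]_N) :
  (2 <= N)%N -> (m < 4)%N -> dft (embC a) = (- 'i) ^+ m *: embC a ->
  (forall j, (Kbound N m <= `|label j|)%N -> a 0 j = 0) -> a = 0.
Proof.
move=> N2 m4 ha supp; have N0 : (0 < N)%N by lia.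
have sN : 0 < Num.sqrt N%:R :> R by rewrite sqrtr_gt0 ltr0n.
have [K0 KM hcount] := Kbound_count N2 m4.
set K := Kbound N m in supp K0 KM hcount; set M := max_label N m in KM hcount.
pose p := cheb_poly m a.
pose rs := [seq cos (omega R N * k%:R) | k <- iota K (M.+1 - K)].
have MN : (M <= N./2)%N by rewrite /M /max_label; case: ifP; lia.
have lab k : (k <= N./2)%N -> exists l : 'I_N, label l = k%:Z.
  by move=> kN; apply/label_bounds; lia.
suff p0 : p = 0.
  apply/rowP => l; have := cheb_polyE l m4 ha; rewrite -/p p0 horner0 mul0r mxE.
  by move/esym/eqP; rewrite !mulf_eq0 signr_eq0 (gt_eqF sN) => /eqP.
have foldsupp j : (K <= `|label j|)%N -> fold_parity m a j = 0.
  by move=> hj; rewrite /fold_parity supp // oppr0 if_same.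
have sp : (size p <= K - odd m)%N.
  apply: leq_trans (size_sum _ _ _) _; apply/bigmax_leqP => j _.
  have [/foldsupp ->|hj] := leqP K `|label j|; first by rewrite scale0r size_poly0.
  apply: leq_trans (size_scale_leq _ _) _; apply: leq_trans (size_cheb _ _ _) _.
  by case: (odd m); lia.
have szrs : size rs = (M.+1 - K)%N by rewrite size_map size_iota.
have rsP : all (root p) rs.
  apply/allP => _ /mapP[k + ->]; rewrite mem_iota => hk.
  have [l lk] := lab k ltac:(lia).
  have := cheb_polyE l m4 ha; rewrite supp ?lk ?mulr0; last by lia.
  move/eqP; rewrite mulf_eq0 => /orP[//|]; rewrite gt_eqF //.
  by apply: trig_weight_gt0; case: (odd m); lia.
have rsU : uniq rs.
  rewrite map_inj_in_uniq ?iota_uniq // => i j; rewrite !mem_iota => hi hj.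
  move/cos_inj; rewrite !omega_itv //; try lia.
  move=> /(_ isT isT) /(mulfI (lt0r_neq0 (omega_gt0 R N0))) /eqP.
  by rewrite eqr_nat => /eqP.
(* Either there are at least as many roots as coefficients, or one fewer. *)
case: hcount => [hle|/and3P[m2 /eqP heq nM]].
  apply/eqP; apply: contraTT hle => p0; rewrite -ltnNge -szrs.
  exact: leq_trans (max_poly_roots p0 rsP rsU) sp.
set n := K.-1 in nM; set r := (M.+1 - K)%N in heq szrs.
have rn : (r + odd m = n)%N by rewrite /n; case: (odd m) heq; lia.
have [l ln] := lab n ltac:(lia).
have pE : p = p`_r *: \prod_(z <- rs) ('X - z%:P).
  by rewrite -szrs; apply: poly_roots_lead => //; rewrite szrs -heq.
(* The coefficient of degree r only sees the labels n and -n, which contribute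
   equally; kappa is positive because both have the same leading coefficient. *)
pose kappa := \sum_(j < N | (`|label j| == n)%N) (cheb R m n)`_r.
have kappa0 : 0 < kappa.
  rewrite /kappa (bigD1 l) ?ln //= ltr_pwDl //; first by rewrite -rn coef_cheb_gt0.
  by apply: sumr_ge0 => j _; rewrite -rn ltW // coef_cheb_gt0.
have pr : p`_r = kappa * a 0 l.
  rewrite coef_sum mulr_suml [RHS]big_mkcond; apply: eq_bigr => j _.
  rewrite coefZ; case: eqP => [jn|jn].
    by rewrite jn mulrC (@fold_parity_abs _ _ _ _ l) // ln jn.
  have [/foldsupp ->|hj] := leqP K `|label j|; first by rewrite mul0r.
  rewrite nth_default ?mulr0 // (leq_trans (size_cheb _ _ _)) //.
  by case: (odd m) rn; lia.
have := cheb_polyE l m4 ha; rewrite -/p [in p.[_]]pE pr hornerZ horner_prod ln.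
set g := trig_weight _ _; set c := \prod_(i <- rs) _.
have g0 : 0 < g by apply: trig_weight_gt0; rewrite -rn; lia.
have c0 : 0 < c.
  rewrite /c big_map big_seq prodr_gt0 // => k; rewrite mem_iota => hk.
  by rewrite hornerXsubC subr_gt0 cos_omega_lt //; lia.
have -> : m./2 = 1%N by lia.
rewrite expr1 => e.
have /eqP : (kappa * c * g + Num.sqrt N%:R) * a 0 l = 0 by rewrite mulrDl; lra.
rewrite mulf_eq0 gt_eqF ?addr_gt0 ?mulr_gt0 //= => /eqP al0.
by rewrite pE pr al0 mulr0 scale0r.
Qed.

(** * Dimensions and the basis *)

Lemma label_abs_le (N : nat) (j : 'I_N) : (`|label j| <= N./2)%N.
Proof. by have := (label_bounds N (label j)).2 (ex_intro _ j erefl); lia. Qed.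

(** The coordinates a(K), ..., a(n) determine [a]: if they vanish, parity makes
    those at -K, ..., -n vanish too, and the support is too small. *)
Lemma dim_eigen_width_le (R : realType) (N m n : nat) :
  (2 <= N)%N -> (m < 4)%N -> (n <= N./2)%N ->
  (\dim (dft_eigenspace R N m :&: width_space R N n)%VS <= n.+1 - Kbound N m)%N.
Proof.
move=> N2 m4 nN; set K := Kbound N m; set U := (_ :&: _)%VS.
pose B : 'M[R]_(N, n.+1 - K) := \matrix_(j, i) (label j == (K + i)%N :> int)%:R.
pose f := linfun (mulmxr B : 'rV[R]_N -> 'rV[R]_(n.+1 - K)).
have kerU : (U :&: lker f = 0)%VS.
  apply/eqP; rewrite -subv0; apply/subvP => a.
  rewrite !memv_cap memv_ker lfunE memv0 /= => /andP[/andP[/mem_dft_eigenspace ha]].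
  move=> /mem_width_space/width_leP hw /eqP aB.
  apply/eqP/(dft_eigenvector_small_support N2 m4 ha) => j Kj.
  have jN := label_abs_le j.
  have [jn|nj] := leqP `|label j| n; last by rewrite -periodic_label hw // nj.
  have [l hl] : exists l : 'I_N, label l = `|label j|%:Z by apply/label_bounds; lia.
  have al : a 0 l = 0.
    have hi : (`|label j| - K < n.+1 - K)%N by lia.
    move/rowP: aB => /(_ (Ordinal hi)); rewrite !mxE /= => <-.
    rewrite (bigD1 l) //= big1 => [|k kl]; rewrite mxE subnKC // -hl.
      by rewrite eqxx mulr1 addr0.
    suff /negbTE -> : label k != label l by rewrite mulr0.
    by apply: contraNneq kl => kl; apply/eqP/label_modz_inj; rewrite kl subrr dvdz0.
  have [j0|j0] := lerP 0 (label j).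
    suff -> : j = l by [].
    by apply: label_modz_inj; rewrite hl gez0_abs // subrr dvdz0.
  by rewrite (eigen_parity (i := j) (j := l) ha) ?al ?mulr0 //; lia.
rewrite -(limg_ker_dim f U) kerU dimv0 add0n.
by rewrite (leq_trans (dimvS (subvf _))) // dimvf /dim /= mul1n.
Qed.

Lemma dft_eigenspace_width (R : realType) (N m : nat) :
  (dft_eigenspace R N m <= width_space R N (max_label N m))%VS.
Proof.
apply/subvP => a /mem_dft_eigenspace ha; apply/mem_width_space/width_leP => k.
rewrite /max_label; case om: (odd m); last by lia.
move=> hk; have N0 : (0 < N)%N by lia.
have [j hj] := exists_label_modz k N0.
(* Only k = N/2 and k = - N/2 with N even are left, and there k and - k agree
   modulo N. *)
have Njj : (N %| label j + label j)%Z.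
  have -> : label j + label j = (k + k) - (k - label j) - (k - label j) by ring.
  apply: (rpredB _ hj); apply: (rpredB _ hj).
  have : k = (N./2)%:Z \/ k = - (N./2)%:Z by lia.
  have -> : N%:Z = (N./2)%:Z + (N./2)%:Z by lia.
  by case=> ->; rewrite ?dvdzz // -opprD rpredN dvdzz.
rewrite (periodic_modz a hj).
have := eigen_sqr ha Njj; have i2 : ('i : R[i]) ^+ 2 = -1 by exact: sqr_i.
rewrite exprAC sqrrN i2 -signr_odd om expr1 => /(congr1 (@complex.Re R)) /=.
lra.
Qed.

Lemma orthonormal_free (R : realType) (N : nat) (s : seq 'rV[R]_N) :
  orthonormal s -> free s.
Proof.
move=> os; rewrite -[s]/(tval (in_tuple s)); apply/freeP => k /= sk i.
have : dot (\sum_(j < size s) k j *: s`_j) s`_i = 0.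
  by rewrite sk /dot big1 // => x _; rewrite mxE mul0r.
rewrite /dot (eq_bigr (fun x =>
  \sum_(j < size s) k j * (s`_j 0 x * s`_i 0 x))); last first.
  by move=> x _; rewrite summxE mulr_suml; apply: eq_bigr => j _; rewrite mxE mulrA.
have e (j : 'I_(size s)) : \sum_x s`_j 0 x * s`_i 0 x = (j == i :> nat)%:R.
  exact: (os j i (ltn_ord j) (ltn_ord i)).
rewrite exchange_big (bigD1 i) //= -mulr_sumr e eqxx mulr1 big1 ?addr0 // => j ji.
by rewrite -mulr_sumr e (inj_eq val_inj) (negbTE ji) mulr0.
Qed.

Lemma orthonormal_mkseq (R : realType) (N d : nat) (T : nat -> 'rV[R]_N)
    (f : nat -> nat) :
  orthonormal (mkseq T N) -> (forall l, (l < d)%N -> (f l < N)%N) ->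
  (forall i j, (i < d)%N -> (j < d)%N -> f i = f j -> i = j) ->
  orthonormal (mkseq (T \o f) d).
Proof.
move=> oT fN finj i j; rewrite size_mkseq => hi hj; rewrite !nth_mkseq //=.
have := oT (f i) (f j); rewrite size_mkseq !nth_mkseq ?fN // => -> //.
suff -> : (f i == f j) = (i == j) by [].
by apply/eqP/eqP => [/finj|->]; auto.
Qed.

Lemma exprNi_add4 (R : realType) (l m : nat) :
  (- 'i : R[i]) ^+ (4 * l + m) = (- 'i) ^+ m.
Proof.
have i4 : (- 'i : R[i]) ^+ 4 = 1 by rewrite (exprM _ 2 2) sqrrN sqr_i sqrrN expr1n.
by rewrite exprD exprM i4 expr1n mul1r.
Qed.

(** The eigenvalue of the last vector is found by exclusion.  In each class m the
    earlier vectors T_(4l+m) already number (N + 2 - m) / 4, and the dimension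
    bound leaves room for one more in a single class. *)
Lemma last_eigenspace (R : realType) (N : nat) (T : nat -> 'rV[R]_N) :
  (2 <= N)%N -> minimal_hermite_basis T ->
  T N.-1 \in dft_eigenspace R N (if (N %% 4 < 2)%N then 0 else 2).
Proof.
move=> N2 [evT eigT [_ oT] _].
have [|T0 [lambda hlam]] := evT N.-1; first by lia.
have [m m4 lamE] := dft_eigenvalueP T0 hlam; rewrite {}lamE in hlam.
pose c := ((N + 2 - m) %/ 4)%N.
pose f l := if (l < c)%N then (4 * l + m)%N else N.-1.
pose s := mkseq (T \o f) c.+1.
have os : orthonormal s.
  apply: orthonormal_mkseq => // [l|i j]; rewrite /f /c; first by case: ifP; lia.
  by case: ifP; case: ifP; lia.
have sU : (<<s>> <= dft_eigenspace R N m :&: width_space R N (max_label N m))%VS.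
  rewrite (capv_idPl (dft_eigenspace_width R N m)); apply/span_subvP => v.
  move=> /mapP[l _ ->] /=; apply/mem_dft_eigenspace; rewrite /f; case: ifP => // lc.
  rewrite eigT; last by move: lc; rewrite /c; lia.
  by rewrite exprNi_add4.
have hM : (max_label N m <= N./2)%N by rewrite /max_label; case: ifP; lia.
have := leq_trans (dimvS sU) (dim_eigen_width_le R N2 m4 hM).
rewrite (eqP (orthonormal_free os)) size_mkseq /c /max_label /Kbound => hc.
have -> : (if (N %% 4 < 2)%N then 0 else 2)%N = m.
  by case: m m4 hc {hlam c f s os sU hM} => [|[|[|[|//]]]] _ /=; case: ifP; lia.
exact/mem_dft_eigenspace.
Qed.

(** The dimension bound equals the number of vectors in the family, so that
    orthonormality makes it a basis.  Only the index 4l + m = N - 1 or N needs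
    [last_eigenspace]. *)
Lemma eigen_width_basis (R : realType) (N m n : nat) (T : nat -> 'rV[R]_N) :
  (2 <= N)%N -> minimal_hermite_basis T -> (m < 4)%N ->
  (Kbound N m <= n <= max_label N m)%N ->
  let U := (dft_eigenspace R N m :&: width_space R N n)%VS in
  let d := (n - Kbound N m + 1)%N in
  \dim U = d /\ orthonormal_basis U (mkseq (fun l => extT T (4 * l + m)) d).
Proof.
move=> N2 hT m4 /andP[Kn nM] U d; have [_ eigT [_ oT] wT] := hT.
have hM : (max_label N m <= N./2)%N by rewrite /max_label; case: ifP; lia.
set s := mkseq _ d.
pose f l := if (4 * l + m == N)%N then N.-1 else (4 * l + m)%N.
have fP l : (l < d)%N -> (f l < N)%N /\
    ((f l < N.-1)%N /\ f l = (4 * l + m)%N \/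
     f l = N.-1 /\ m = if (N %% 4 < 2)%N then 0%N else 2%N).
  move: Kn nM; rewrite /f /d /Kbound /max_label.
  by case: m m4 {U d hM s f} => [|[|[|[|//]]]] _ /=; case: ifP; case: ifP; lia.
have sE : s = mkseq (T \o f) d.
  by apply: eq_mkseq => l; rewrite /extT /f /=; case: ifP.
have os : orthonormal s.
  rewrite sE; apply: orthonormal_mkseq => // [l /fP[]//|i j].
  by rewrite /f => hi hj; case: ifP; case: ifP; lia.
have sU : (<<s>> <= U)%VS.
  apply/span_subvP => v; rewrite sE => /mapP[l + ->] /=.
  rewrite mem_iota add0n => /andP[_ hl].
  have [fN hf] := fP l hl.
  rewrite memv_cap; apply/andP; split; last first.
    apply/mem_width_space/(leq_trans (wT _ fN)).
    move: hl Kn; rewrite /f /d /Kbound; case: eqP; lia.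
  case: hf => -[h1 h2]; last by rewrite h1 h2 last_eigenspace.
  apply/mem_dft_eigenspace; rewrite eigT // h2.
  by rewrite exprNi_add4.
have dU : (\dim U <= d)%N.
  by rewrite (leq_trans (dim_eigen_width_le _ _ _ _)) // /d; lia.
have bU : basis_of U s.
  by rewrite basisEfree orthonormal_free // sU /s size_mkseq dU.
by split; [rewrite (size_basis bU) | split].
Qed.

Lemma eigen_width_trivial (R : realType) (N m n : nat) :
  (2 <= N)%N -> (m < 4)%N -> (n < Kbound N m)%N ->
  \dim (dft_eigenspace R N m :&: width_space R N n)%VS = 0%N.
Proof.
move=> N2 m4 nK; apply/eqP; rewrite -leqn0.
have [_ KM _] := Kbound_count N2 m4.
have hM : (max_label N m <= N./2)%N by rewrite /max_label; case: ifP; lia.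
by rewrite (leq_trans (dim_eigen_width_le _ N2 m4 _)) //; lia.
Qed.

Theorem proposition1p5 (R : realType) (N : nat) (hN : (2 <= N)%N)
    (T : nat -> 'rV[R]_N) (hT : minimal_hermite_basis T) :
  (forall n : nat,
     ((n < Kbound N 0)%N -> \dim (dft_eigenspace R N 0 :&: width_space R N n)%VS = 0%N) /\
     ((Kbound N 0 <= n <= N./2)%N ->
        \dim (dft_eigenspace R N 0 :&: width_space R N n)%VS = (n - Kbound N 0 + 1)%N /\
        orthonormal_basis (dft_eigenspace R N 0 :&: width_space R N n)%VS
          (mkseq (fun l => extT T (4 * l)) (n - Kbound N 0 + 1)))) /\
  (forall n : nat,
     ((n < Kbound N 1)%N -> \dim (dft_eigenspace R N 1 :&: width_space R N n)%VS = 0%N) /\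
     ((Kbound N 1 <= n < uphalf N)%N ->
        \dim (dft_eigenspace R N 1 :&: width_space R N n)%VS = (n - Kbound N 1 + 1)%N /\
        orthonormal_basis (dft_eigenspace R N 1 :&: width_space R N n)%VS
          (mkseq (fun l => extT T (4 * l + 1)) (n - Kbound N 1 + 1)))) /\
  (forall n : nat,
     ((n < Kbound N 2)%N -> \dim (dft_eigenspace R N 2 :&: width_space R N n)%VS = 0%N) /\
     ((Kbound N 2 <= n <= N./2)%N ->
        \dim (dft_eigenspace R N 2 :&: width_space R N n)%VS = (n - Kbound N 2 + 1)%N /\
        orthonormal_basis (dft_eigenspace R N 2 :&: width_space R N n)%VS
          (mkseq (fun l => extT T (4 * l + 2)) (n - Kbound N 2 + 1)))) /\
  (forall n : nat,
     ((n < Kbound N 3)%N -> \dim (dft_eigenspace R N 3 :&: width_space R N n)%VS = 0%N) /\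
     ((Kbound N 3 <= n < uphalf N)%N ->
        \dim (dft_eigenspace R N 3 :&: width_space R N n)%VS = (n - Kbound N 3 + 1)%N /\
        orthonormal_basis (dft_eigenspace R N 3 :&: width_space R N n)%VS
          (mkseq (fun l => extT T (4 * l + 3)) (n - Kbound N 3 + 1)))).
Proof.
have aux m n (m4 : (m < 4)%N) := eigen_width_basis (n := n) hN hT m4.
have triv m n (m4 : (m < 4)%N) := @eigen_width_trivial R N m n hN m4.
split=> [n|]; last split=> [n|]; last split=> [n|]; last move=> n.
all: split=> [|/andP[Kn nM]]; first exact: triv.
- have [-> bU] := aux 0%N n isT (introT andP (conj Kn nM)); split=> //.
  by under eq_mkseq do rewrite -[(4 * _)%N]addn0.
- by apply: aux => //; rewrite Kn /max_label /=; lia.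
- by apply: aux => //; rewrite Kn.
- by apply: aux => //; rewrite Kn /max_label /=; lia.
Qed.
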